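(* Let $m\ge 1$, let $P_2=[u_1,u_2]$ be the path on two vertices and let $P_m=[v_1,v_2,\dots,v_m]$ be the path on $m$ vertices. Then the harmonic centrality of any vertex $(u_i,v_j)$ of the Cartesian product $P_2\square P_m$ is $$\mathcal{H}_{P_2\square P_m}(u_i,v_j)=\begin{cases}\dfrac{1}{2m-1}\Big(2H_{m-1}+\dfrac1m\Big) & \text{for } 1\le i\le 2,\ j=1 \text{ or } j=m,\\[2mm] \dfrac{1}{2m-1}\Big[2\big(H_{j-1}+H_{m-j}\big)+\dfrac1j+\dfrac{1}{m-j+1}-1\Big] & \text{for } 1\le i\le 2,\ 1<j<m.\end{cases}$$
   Context: All graphs are simple, undirected and finite. For a graph $G$ of order $n\ge 2$ (number of vertices) and a vertex $u$, the harmonic centrality of $u$ is $\mathcal{H}_G(u)=\frac{\mathcal{R}_G(u)}{n-1}$, where $\mathcal{R}_G(u)=\sum_{x\in V(G),\,x\ne u}\frac{1}{d(u,x)}$, $d$ is the shortest-path distance in $G$, and $\frac{1}{d(u,x)}=0$ if there is no path from $u$ to $x$. $H_n=\sum_{k=1}^n \frac1k$ is the $n$-th harmonic number (with $H_0=0$). The path $[v_1,\dots,v_m]$ has edges $v_kv_{k+1}$ for $1\le k<m$. The Cartesian product $G\square H$ has vertex set $V(G)\times V(H)$, with $(u,v)$ and $(u',v')$ adjacent iff either $u=u'$ and $v,v'$ are adjacent in $H$, or $v=v'$ and $u,u'$ are adjacent in $G$. *)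

(* Defs.v *)
From HB Require Import structures.
From mathcomp Require Import all_boot all_order all_algebra.

Set Implicit Arguments.
Unset Strict Implicit.
Unset Printing Implicit Defensive.

Import Order.TTheory GRing.Theory Num.Theory.
Local Open Scope ring_scope.

Record sgraph := SGraph {
  vertex :> finType;
  adj : rel vertex;
  adj_sym : symmetric adj;
  adj_irrefl : irreflexive adj }.

Section Distance.
Variable G : sgraph.

(* MathComp's [path e u p] only asserts that u :: p is a walk, with [size p]
   edges; the [uniq] conjunct makes it a path in the graph-theoretic sense. *)
Definition path_of_length (u x : G) (n : nat) : bool :=
  [exists p : n.-tuple G,
    [&& path (@adj G) u p, uniq (u :: p) & last u p == x]].

Lemma connect_path_of_length (u x : G) :
  connect (@adj G) u x -> exists n, path_of_length u x n.
Proof.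
case/connectP=> p up ->; case/shortenP: up => q uq Uq _.
by exists (size q); apply/existsP; exists (in_tuple q); rewrite uq Uq eqxx.
Qed.

(* [None] stands for the absence of a path from u to x. *)
Definition distance (u x : G) : option nat :=
  match @idP (connect (@adj G) u x) with
  | ReflectT c => Some (ex_minn (connect_path_of_length c))
  | ReflectF _ => None
  end.

Definition inv_distance (R : realFieldType) (u x : G) : R :=
  if distance u x is Some d then d%:R^-1 else 0.

Definition total_inv_distance (R : realFieldType) (u : G) : R :=
  \sum_(x : G | x != u) inv_distance R u x.

(* Meaningful for graphs with at least two vertices. *)
Definition harmonic_centrality (R : realFieldType) (u : G) : R :=
  total_inv_distance R u / (#|G|%:R - 1).

End Distance.

Definition harmonic_number (R : realFieldType) (n : nat) : R :=
  \sum_(1 <= k < n.+1) k%:R^-1.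

(* The vertex v_j of the path [v_1, ..., v_m] is the ordinal of value j - 1. *)
Definition path_adj (m : nat) : rel 'I_m :=
  fun a b => (a.+1 == b)%N || (b.+1 == a)%N.

Lemma path_adj_sym m : symmetric (@path_adj m).
Proof. by move=> a b; rewrite /path_adj orbC. Qed.

Lemma path_adj_irrefl m : irreflexive (@path_adj m).
Proof. by move=> a; rewrite /path_adj orbb gtn_eqF. Qed.

Definition path_graph (m : nat) : sgraph :=
  SGraph (@path_adj_sym m) (@path_adj_irrefl m).

Section CartesianProduct.
Variables G H : sgraph.

Definition cartesian_adj : rel (G * H)%type := fun p q =>
  ((p.1 == q.1) && adj p.2 q.2) || ((p.2 == q.2) && adj p.1 q.1).

Lemma cartesian_adj_sym : symmetric cartesian_adj.
Proof.
move=> p q; rewrite /cartesian_adj (eq_sym p.1) (eq_sym p.2).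
by rewrite (adj_sym p.1) (adj_sym p.2).
Qed.

Lemma cartesian_adj_irrefl : irreflexive cartesian_adj.
Proof. by move=> p; rewrite /cartesian_adj !adj_irrefl !andbF. Qed.

Definition cartesian_product : sgraph :=
  SGraph cartesian_adj_sym cartesian_adj_irrefl.

End CartesianProduct.

(* Main.v *)
Require Import Defs.
From mathcomp Require Import all_boot all_order all_algebra.
From mathcomp Require Import zify ring.

Import Order.TTheory GRing.Theory Num.Theory.
Local Open Scope ring_scope.

(** The distance from (i, k) to (a, b) in a product of two paths is
    |a - i| + |b - k|: this function drops by one along a suitable edge and
    never changes by more than one along any edge. Summing inverses over the row
    of (i, k) gives H_(j-1) + H_(m-j), and over the other row, where every
    distance grows by one, H_j + H_(m-j+1) - 1. For j = 1 and j = m the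
    resulting interior formula specializes to the boundary one. *)

Lemma path_potential_le {G : sgraph} {f : G -> nat} :
  (forall x y, adj x y -> (f y <= (f x).+1)%N) ->
  forall p u, path (@adj G) u p -> (f (last u p) <= f u + size p)%N.
Proof.
move=> lipf; elim=> [|y p IHp] u /=; first by rewrite addn0.
case/andP=> /lipf fy /IHp le_f.
by rewrite addnS -addSn (leq_trans le_f) // leq_add2r.
Qed.

(** Following descending edges back from [x] must end at [u], the only possible zero of [f]. *)
Lemma path_of_potential {G : sgraph} {u : G} {f : G -> nat} :
  (forall x, f x = 0%N -> x = u) ->
  (forall x, (0 < f x)%N -> exists2 y, adj y x & (f y).+1 = f x) ->
  forall x, exists p, [/\ path (@adj G) u p, last u p = x & size p = f x].
Proof.
move=> f0 descf x; move Dn: (f x) => n; elim: n x Dn => [|n IHn] x Dn.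
  by exists [::]; rewrite (f0 _ Dn).
have [|y yx] := descf x; first by rewrite Dn.
rewrite Dn => -[/IHn[p [up py sz_p]]].
by exists (rcons p x); rewrite rcons_path last_rcons size_rcons up py sz_p.
Qed.

(** The Lipschitz bound makes every walk from [u] to [x] at least [f x] long; descent supplies one
    of exactly that length. *)
Lemma distance_potential (G : sgraph) (u : G) (f : G -> nat) :
  f u = 0%N ->
  (forall x, f x = 0%N -> x = u) ->
  (forall x y, adj x y -> (f y <= (f x).+1)%N) ->
  (forall x, (0 < f x)%N -> exists2 y, adj y x & (f y).+1 = f x) ->
  forall x, distance u x = Some (f x).
Proof.
move=> fu f0 lipf descf x.
have [p [up px sz_p]] := path_of_potential f0 descf x.
rewrite /distance; destruct idP as [c|[]]; last by apply/connectP; exists p.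
congr Some; case: ex_minnP => n /existsP[q /and3P[uq _ /eqP qx]] n_min.
apply/eqP; rewrite eqn_leq; apply/andP; split; last first.
  by have := path_potential_le lipf _ _ uq; rewrite qx fu size_tuple.
(* The walk [p] is not known to be [uniq], as [path_of_length] demands; its shortening [r] is, and
   is no longer than [p]. *)
case/shortenP: up px => r ur Ur sub_rp rx.
apply: (@leq_trans (size r)).
  by apply: n_min; apply/existsP; exists (in_tuple r); rewrite ur Ur rx eqxx.
by rewrite -sz_p uniq_leq_size //; case/andP: Ur.
Qed.

(** Truncated subtraction kills one summand, leaving the absolute difference. *)
Definition natdist (a b : nat) : nat := ((a - b) + (b - a))%N.

Lemma path_graph_descent {m : nat} (k b : 'I_m) : (0 < natdist k b)%N ->
  exists2 c : 'I_m, path_adj c b & (natdist k c).+1 = natdist k b.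
Proof.
(* The witness is the neighbour of [b] on the side of [k], so it stays below [m]. *)
rewrite /natdist /path_adj => kb; have [lt_bk|le_kb] := ltnP b k.
  have lt_b1m : (b.+1 < m)%N by have := ltn_ord k; lia.
  by exists (Ordinal lt_b1m) => /=; lia.
have lt_b1m : (b.-1 < m)%N by have := ltn_ord b; lia.
by exists (Ordinal lt_b1m) => /=; lia.
Qed.

Lemma distance_grid (n m : nat)
    (x y : cartesian_product (path_graph n) (path_graph m)) :
  distance x y = Some (natdist x.1 y.1 + natdist x.2 y.2)%N.
Proof.
move: y; apply: distance_potential => [|[a b]|[a b] [a' b']|[a b]] /=.
- by rewrite /natdist !subnn.
- case: x => i k /=; rewrite /natdist => d0.
  by congr pair; apply: val_inj => /=; lia.
- rewrite /cartesian_adj /= /path_adj /natdist.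
  by case/orP=> /andP[/eqP->]; lia.
case: x => i k /=; rewrite addn_gt0.
(* Descend in the second coordinate once the first agrees with [i], and in the first otherwise. *)
have [a0|] := posnP (natdist i a) => /=.
  case/path_graph_descent=> c cb dc.
  by exists (a, c); rewrite /= ?/cartesian_adj /= ?eqxx ?cb // -dc addnS.
case/path_graph_descent=> c ca dc _.
by exists (c, b); rewrite /= ?/cartesian_adj /= ?eqxx ?ca ?orbT // -dc addSn.
Qed.

(* The distance 0 is counted once on the left and twice on the right. *)
Lemma sum_natdist (V : nmodType) (F : nat -> V) (m : nat) (k : 'I_m) :
  \sum_(b < m) F (natdist k b) + F 0%N =
  \sum_(d < k.+1) F d + \sum_(d < m - k) F d.
Proof.
have lt_km := ltn_ord k.
rewrite -(big_mkord xpredT (fun b => F (natdist k b))).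
rewrite (@big_cat_nat _ _ _ k) //=; last exact: ltnW.
(* Reversed, the part left of [k] has distances 1, ..., [k]; the extra [F 0] supplies its missing
   initial term. *)
rewrite big_nat_rev big_mkord.
rewrite -[X in \sum_(X <= _ < m) _]add0n big_addn big_mkord.
rewrite big_ord_recl [F 0%N + _]addrC addrAC.
congr (_ + _ + _); apply: eq_bigr => d _; congr F; rewrite /natdist.
  by have := ltn_ord d; rewrite lift0; lia.
by lia.
Qed.

Lemma harmonic_number_sum (R : realFieldType) (n : nat) :
  harmonic_number R n = \sum_(d < n) d.+1%:R^-1.
Proof. by rewrite /harmonic_number big_add1 big_mkord. Qed.

Lemma harmonic_number_sum0 (R : realFieldType) (n : nat) :
  harmonic_number R n = \sum_(d < n.+1) d%:R^-1.
Proof. by rewrite harmonic_number_sum big_ord_recl invr0 add0r. Qed.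

Lemma harmonic_numberS (R : realFieldType) (n : nat) :
  harmonic_number R n.+1 = harmonic_number R n + n.+1%:R^-1.
Proof. by rewrite !harmonic_number_sum big_ord_recr. Qed.

Lemma total_inv_distance_ladder (R : realFieldType) (m : nat)
    (i : 'I_2) (k : 'I_m) :
  let H := harmonic_number R in
  total_inv_distance R
    ((i, k) : cartesian_product (path_graph 2) (path_graph m)) =
  2 * (H k + H (m - k.+1)%N) + k.+1%:R^-1 + (m - k)%:R^-1 - 1.
Proof.
move=> H; have lt_km := ltn_ord k.
pose F a b : R := (natdist i a + natdist k b)%:R^-1.
transitivity (\sum_(a < 2) \sum_(b < m) F a b).
  rewrite pair_bigA [RHS](bigD1 (i, k)) //=.
  (* The vertex itself may join the sum, since the inverse of 0 is 0 in [R]. *)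
  rewrite {1}/F /natdist !subnn invr0 add0r.
  by apply: eq_bigr => x _; rewrite /inv_distance distance_grid.
have Emk : (m - k = (m - k.+1).+1)%N by lia.
have row0 : \sum_(b < m) (natdist k b)%:R^-1 = H k + H (m - k.+1)%N.
  have := sum_natdist _ (fun d => d%:R^-1 : R) _ k.
  by rewrite invr0 addr0 Emk -!harmonic_number_sum0.
have row1 : \sum_(b < m) (1 + natdist k b)%:R^-1 =
    H k + H (m - k.+1)%N + k.+1%:R^-1 + (m - k)%:R^-1 - 1.
  have := sum_natdist _ (fun d => d.+1%:R^-1 : R) _ k.
  (* The term at distance 0 is now 1, whence the [- 1]; the two fractions are the last terms of
     [H k.+1] and [H (m - k)]. *)
  rewrite -!harmonic_number_sum Emk !harmonic_numberS invr1 -/H.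
  by move/(canRL (addrK _)) => E; apply: (etrans E); ring.
have -> : \sum_(a < 2) \sum_(b < m) F a b =
    \sum_(b < m) (natdist k b)%:R^-1 + \sum_(b < m) (1 + natdist k b)%:R^-1.
  rewrite big_ord_recl big_ord1 /F.
  by case: i {F} => -[|[|//]] ? //=; rewrite addrC.
by rewrite row0 row1; ring.
Qed.

Theorem theorem3p1 (R : realFieldType) (m : nat) (hm : (1 <= m)%N)
    (i : 'I_2) (k : 'I_m) :
  let j := k.+1 in
  let H := harmonic_number R in
  harmonic_centrality R
    ((i, k) : cartesian_product (path_graph 2) (path_graph m)) =
  if (j == 1)%N || (j == m)%N then
    1 / (2 * m%:R - 1) * (2 * H (m - 1)%N + 1 / m%:R)
  else
    1 / (2 * m%:R - 1) *
      (2 * (H (j - 1)%N + H (m - j)%N)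
       + 1 / j%:R + 1 / (m - j + 1)%N%:R - 1).
Proof.
move=> j H; have lt_km := ltn_ord k.
rewrite /harmonic_centrality total_inv_distance_ladder -/H -/j.
rewrite card_prod !card_ord natrM mulrC !div1r.
have H0 : H 0%N = 0 by rewrite /H harmonic_number_sum big_ord0.
have Ej : (m - j + 1 = m - k)%N by rewrite /j; lia.
(* At an end of the path one harmonic sum is empty and the reciprocal on that side is 1, cancelling
   the [- 1]. *)
rewrite Ej; case: ifP => [/orP[] /eqP Dj|_]; congr (_ * _); last first.
- by rewrite /j subn1.
- have [-> -> ->] : [/\ k = m - 1 :> nat, m - j = 0 & m - k = 1]%N.
    by rewrite /j in Dj *; split; lia.
  by rewrite H0 invr1 Dj; ring.
have [-> -> ->] : [/\ k = 0 :> nat, m - j = m - 1 & m - k = m]%N.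
  by rewrite /j in Dj *; split; lia.
by rewrite H0 Dj invr1; ring.
Qed.
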